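(* Let $d \ge 1$ and $n_1,\ldots,n_d \ge 1$ be integers. For every $X \in \mathbb{C}^{n_1 \times \cdots \times n_d}$ and every $S \subseteq [1:d]$, the ANOVA component of $X$ indexed by $S$ can be expressed as $$ \Pi_S(X) = \mathcal{F}^{-1}\big( M_S \odot \mathcal{F}(X) \big), $$ where $\mathcal{F}$ is the $d$-dimensional discrete Fourier transform on $\mathbb{C}^{n_1 \times \cdots \times n_d}$, $\odot$ is the entrywise product, and the mask $M_S \in \{0,1\}^{n_1 \times \cdots \times n_d}$ is given for $\mathbf{i} = (i_1,\ldots,i_d) \in [1:n_1] \times \cdots \times [1:n_d]$ by $$ (M_S)_{\mathbf{i}} = \begin{cases} 1 & \text{if } i_j \neq 1 \text{ for all } j \in S \text{ and } i_\ell = 1 \text{ for all } \ell \notin S, \\ 0 & \text{otherwise.} \end{cases} $$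
   Context: Notation: $[1:n] = \{1,\ldots,n\}$. ANOVA projectors: for $\ell \in [1:d]$, the operator $P_{-\ell}$ averages out the $\ell$-th variable, i.e. $$ (P_{-\ell} X)[i_1,\ldots,i_d] = \frac{1}{n_\ell} \sum_{k=1}^{n_\ell} X[i_1,\ldots,i_{\ell-1},k,i_{\ell+1},\ldots,i_d]. $$ These operators commute with one another, and for $S \subseteq [1:d]$, $$ \Pi_S := \prod_{j \in S} (\mathrm{Id} - P_{-j}) \prod_{\ell \in [1:d] \setminus S} P_{-\ell}. $$ Fourier transform convention: for each $j$, let $(\varphi^{(j)}_1,\ldots,\varphi^{(j)}_{n_j})$ be the (unnormalized) Fourier basis of $\mathbb{C}^{n_j}$, i.e. $\varphi^{(j)}_i[k] = e^{2\pi \sqrt{-1}\,(i-1)(k-1)/n_j}$ for $i,k \in [1:n_j]$, so that $\varphi^{(j)}_1$ is the all-one vector. With $\phi_{\mathbf{i}} := \varphi^{(1)}_{i_1} \otimes \cdots \otimes \varphi^{(d)}_{i_d}$, the transform $\mathcal{F}$ produces the discrete Fourier coefficients of $X$, i.e. $\mathcal{F}(X)$ is the unique tensor such that $X = \sum_{\mathbf{i}} \mathcal{F}(X)_{\mathbf{i}} \, \phi_{\mathbf{i}}$, and $\mathcal{F}^{-1}(Z) = \sum_{\mathbf{i}} Z_{\mathbf{i}}\, \phi_{\mathbf{i}}$. *)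

(* Defs.v *)
From HB Require Import structures.
From mathcomp Require Import all_boot all_order all_algebra.
From mathcomp Require Import classical_sets reals trigo.
From mathcomp Require Import complex.

Set Implicit Arguments.
Unset Strict Implicit.
Unset Printing Implicit Defensive.

Import Order.TTheory GRing.Theory Num.Theory.
Local Open Scope ring_scope.
Local Open Scope complex_scope.

Definition multi_index (d : nat) (n : 'I_d -> nat) : finType :=
  {dffun forall j : 'I_d, 'I_(n j)}.

(* C is R[i].  Every index range is 0-based: the first index 1 of [1:n_j] is
   encoded by the ordinal of value 0, and i - 1 by the value of i itself. *)
Definition tensor (R : realType) (d : nat) (n : 'I_d -> nat) :=
  {ffun multi_index n -> R[i]}.

Section Anova.
Context (R : realType) (d : nat) (n : 'I_d -> nat).
Implicit Types (X Z : tensor R n) (i k : multi_index n).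

Definition set_coord i (l : 'I_d) (m : 'I_(n l)) : multi_index n :=
  [ffun j => dfwith i m j].

Definition average (l : 'I_d) X : tensor R n :=
  [ffun i => (n l)%:R^-1 * \sum_(m < n l) X (set_coord i m)].

(* The products of operators are compositions, taken in the order of the
   enumeration of 'I_d; this order is immaterial as the averages commute. *)
Definition anova (S : {set 'I_d}) : tensor R n -> tensor R n :=
  (\big[comp/id]_(j in S) (fun X => X - average j X)) \o
  (\big[comp/id]_(l in ~: S) average l).

Definition expi (t : R) : R[i] := cos t +i* sin t.

Definition fourier1 (m : nat) (p k : 'I_m) : R[i] :=
  expi (2 * pi * (p * k)%:R / m%:R).

Definition fourier i : tensor R n :=
  [ffun k : multi_index n => \prod_(j < d) fourier1 (i j) (k j)].

Definition idft Z : tensor R n :=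
  [ffun k => \sum_(i : multi_index n) Z i * fourier i k].

(* [fourier] is a basis, so the set below is a singleton and the default value
   0 of [xget] is never used. *)
Definition dft X : tensor R n :=
  xget (0 : tensor R n) [set Z : tensor R n | X = idft Z]%classic.

Definition anova_mask (S : {set 'I_d}) : tensor R n :=
  [ffun i : multi_index n =>
     ([forall (j | j \in S), i j != 0%N :> nat] &&
      [forall (l | l \notin S), i l == 0%N :> nat])%:R].

Definition hadamard X Z : tensor R n := [ffun i => X i * Z i].

End Anova.

(* Main.v *)
Require Import Defs.
From HB Require Import structures.
From mathcomp Require Import all_boot all_order all_algebra.
From mathcomp Require Import classical_sets reals trigo.
From mathcomp Require Import complex.

(** Every Fourier tensor is an eigenvector of every [average l]: its factor
    along the axis [l] is a character of Z/n_l, whose mean is 1 for the trivial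
    character (index 0) and 0 otherwise.  Hence [anova S] acts diagonally on
    Fourier coefficients, and the product of the eigenvalues is the mask. *)

Set Implicit Arguments.
Unset Strict Implicit.
Unset Printing Implicit Defensive.

Import Order.TTheory GRing.Theory Num.Theory.
Local Open Scope ring_scope.
Local Open Scope complex_scope.

(** Distributivity for dependent index ranges: it splits a sum over multi-indices axis by axis. *)
Lemma big_dffun_prod (K : comNzRingType) (I : finType) (T : I -> finType)
    (F : forall i, T i -> K) :
  \sum_(f : {dffun forall i, T i}) \prod_i F i (f i) = \prod_i \sum_x F i x.
Proof.
rewrite (reindex (@dffun_of_fprod _ T)); last exact/onW_bij/dffun_of_fprod_bij.
pose P i := [ffun x => F i x].
transitivity (\sum_(t : fprod T) \prod_i P i (t i)).
  by apply: eq_bigr => t _; apply: eq_bigr => i _; rewrite !ffunE.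
(* Dependent functions become plain functions into the tagged sum of the [T i], where ordinary
   distributivity applies; [untag 0] extends each factor by zero outside its own fibre. *)
rewrite big_fprod -(bigA_distr_big_dep _ (fun i => untag 0 (P i))).
apply: eq_bigr => i _; rewrite -(big_tag (fun i => P i) i).
by apply: eq_bigr => x _; rewrite ffunE.
Qed.

Lemma prod_natr_bool (K : comNzRingType) (I : finType) (P b : pred I) :
  \prod_(i | P i) (b i)%:R = [forall (i | P i), b i]%:R :> K.
Proof.
rewrite -big_andE (big_morph (fun c : bool => c%:R) (id1 := 1) (op1 := *%R)) //.
by move=> x y; rewrite -mulnb natrM.
Qed.

(** A geometric sum of ratio z = w^p / w^q: primitivity gives z = 1 exactly when p = q, and
    otherwise (z - 1) times the sum is z^m - 1 = 0. *)
Lemma sum_ratio_unity_root (F : fieldType) m (w : F) (p q : nat) :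
  m.-primitive_root w -> (p < m)%N -> (q < m)%N ->
  \sum_(k < m) (w ^+ p / w ^+ q) ^+ k = m%:R * (p == q)%:R.
Proof.
move=> prw ltpm ltqm; set z := w ^+ p / w ^+ q.
have w_neq0 : w != 0 by rewrite (prim_root_eq0 prw) -lt0n (prim_order_gt0 prw).
have z1E : (z == 1) = (p == q).
  rewrite -(inj_eq (mulIf (expf_neq0 q w_neq0))) mul1r divfK ?expf_neq0 //.
  by rewrite (eq_prim_root_expr prw) !modn_small.
have [pq|pq] := eqVneq p q.
  have /eqP -> : z == 1 by rewrite z1E pq.
  under eq_bigr => k _ do rewrite expr1n.
  by rewrite sumr_const card_ord mulr1.
have z_neq1 : z - 1 != 0 by rewrite subr_eq0 z1E.
have zm : z ^+ m = 1.
  rewrite expr_div_n -!exprM ![(_ * m)%N]mulnC !exprM (prim_expr_order prw).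
  by rewrite !expr1n divr1.
apply: (mulfI z_neq1); rewrite -subrX1 zm subrr mulr0.
by rewrite mulr0.
Qed.

Section Fourier.
Context (R : realType).

Lemma expi0 : expi (0 : R) = 1.
Proof. by rewrite /expi cos0 sin0. Qed.

Lemma expiD (s t : R) : expi (s + t) = expi s * expi t.
Proof.
by apply/eqP; rewrite eq_complex /= cosD sinD [X in _ && (X == _)]addrC !eqxx.
Qed.

Lemma expi_natM (t : R) k : expi (k%:R * t) = expi t ^+ k.
Proof.
elim: k => [|k IHk]; first by rewrite mul0r expi0.
by rewrite -natr1 mulrDl mul1r expiD IHk exprSr.
Qed.

Lemma expi_2pi : expi (2 * pi : R) = 1.
Proof. by rewrite mulr_natl /expi cos2pi sin2pi. Qed.

(** Half-angle argument: cos t = 1 - 2 sin^2(t/2), and sin(t/2) > 0 because t/2 lies in (0, pi). *)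
Lemma expi_neq1 (t : R) : 0 < t < 2 * pi -> expi t != 1.
Proof.
move=> /andP[t_gt0 t_lt]; apply/eqP => -[cost _].
have sint : 0 < sin (t / 2).
  by apply: sin_gt0_pi; rewrite divr_gt0 //= ltr_pdivrMr // mulrC.
have : cos (t / 2 *+ 2) = 1 by rewrite -[_ *+ 2]mulr_natr divfK ?pnatr_eq0.
rewrite cos_mulr2n cos2sin2 => /eqP; apply/negP.
rewrite subr_eq -mulr2n eqr_pMn2r // -[eqbRHS]subr0 (inj_eq (addrI 1)).
by rewrite eqr_opp expf_eq0 /= gt_eqF.
Qed.

Lemma expi_prim_root m :
  (0 < m)%N -> m.-primitive_root (expi (2 * pi / m%:R : R)).
Proof.
move=> m_gt0; have m_neq0 : m%:R != 0 :> R by rewrite pnatr_eq0 -lt0n.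
have pow1 : expi (2 * pi / m%:R : R) ^+ m = 1.
  by rewrite -expi_natM mulrC divfK // expi_2pi.
(* If the exact order m' were smaller than m, the angle 2 pi m'/m would lie strictly between 0 and 2
   pi, against [expi_neq1]. *)
have [m' prm' dvdm'] := prim_order_exists m_gt0 pow1.
have [mm'|neqm'] := eqVneq m m'; first by rewrite {1}mm'.
have ltm' : (m' < m)%N by rewrite ltn_neqAle eq_sym neqm' dvdn_leq.
have := prim_expr_order prm'; rewrite -expi_natM => /eqP/negP[].
have pi2_gt0 : 0 < 2 * pi :> R by rewrite mulr_gt0 ?pi_gt0.
apply/negP/expi_neq1; rewrite mulrCA pmulr_rgt0 // gtr_pMr //.
rewrite divr_gt0 ?ltr0n ?(prim_order_gt0 prm') //=.
by rewrite ltr_pdivrMr ?ltr0n // mul1r ltr_nat.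
Qed.

Lemma fourier1E m (p k : 'I_m) :
  fourier1 R p k = expi (2 * pi / m%:R) ^+ (p * k).
Proof. by rewrite -expi_natM /fourier1 mulrAC mulrC. Qed.

(** Dividing by an entry stands for multiplying by its conjugate, as entries have modulus 1. The sum
    runs over frequencies, so the positions [k] and [l] become the exponents of the geometric
    sum. *)
Lemma fourier1_orthogonal m (k l : 'I_m) :
  \sum_p fourier1 R p k / fourier1 R p l = m%:R * (k == l)%:R.
Proof.
have prw := expi_prim_root (leq_ltn_trans (leq0n k) (ltn_ord k)).
rewrite -(sum_ratio_unity_root prw (ltn_ord k) (ltn_ord l)).
apply: eq_bigr => p _.
by rewrite !fourier1E expr_div_n -!exprM ![(_ * p)%N]mulnC.
Qed.

Lemma sum_fourier1 m (p : 'I_m) :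
  \sum_k fourier1 R p k = m%:R * (p == 0 :> nat)%:R.
Proof.
have m_gt0 := leq_ltn_trans (leq0n p) (ltn_ord p).
rewrite -(sum_ratio_unity_root (expi_prim_root m_gt0) (ltn_ord p) m_gt0).
by apply: eq_bigr => k _; rewrite fourier1E expr0 divr1 exprM.
Qed.

Context (d : nat) (n : 'I_d -> nat).
Context (n_gt0 : forall j, (0 < n j)%N).
Implicit Types (X Z : tensor R n) (i k : multi_index n).

Lemma fourier_orthogonal k l :
  \sum_i fourier R i k / fourier R i l = (\prod_j (n j)%:R) * (k == l)%:R.
Proof.
transitivity (\sum_(i : multi_index n)
    \prod_j (fourier1 R (i j) (k j) / fourier1 R (i j) (l j))).
  by apply: eq_bigr => i _; rewrite prodf_div !ffunE.
rewrite (big_dffun_prod (fun j p => fourier1 R p (k j) / fourier1 R p (l j))).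
under eq_bigr => j _ do rewrite fourier1_orthogonal.
rewrite big_split /= prod_natr_bool; congr (_ * (nat_of_bool _)%:R).
apply/forallP/eqP => [e|-> j]; last exact: eqxx.
by apply/ffunP => j; apply/eqP/e.
Qed.

Lemma idft_dft X : idft (dft X) = X.
Proof.
(* [dft] picks a preimage under [idft], so it suffices to exhibit one. *)
apply/esym/(@xgetPex _ 0 [set Z | X = idft Z]%classic).
(* The classical inversion formula, with division in place of conjugation. *)
exists [ffun i => (\prod_j (n j)%:R)^-1 * \sum_l X l / fourier R i l].
apply/ffunP => k; rewrite ffunE.
transitivity ((\prod_j (n j)%:R)^-1 *
    \sum_i \sum_l X l * (fourier R i k / fourier R i l)); last first.
  rewrite mulr_sumr; apply: eq_bigr => i _.
  rewrite [X in _ = X * _]ffunE -mulrA mulr_suml; congr (_ * _).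
  by apply: eq_bigr => l _; rewrite mulrA mulrAC.
rewrite exchange_big /=.
rewrite (eq_bigr (fun l => (\prod_j (n j)%:R) * (X l * (k == l)%:R)));
  last first.
  by move=> l _; rewrite -mulr_sumr fourier_orthogonal mulrCA.
rewrite -mulr_sumr mulKf; last first.
  by apply/prodf_neq0 => j _; rewrite pnatr_eq0 -lt0n.
rewrite (bigD1 k) //= eqxx mulr1 big1 ?addr0 // => l lk.
by rewrite eq_sym (negbTE lk) mulr0.
Qed.

Lemma average_fourier (l : 'I_d) i k :
  average l (fourier R i) k = (i l == 0 :> nat)%:R * fourier R i k.
Proof.
rewrite !ffunE.
(* Changing coordinate [l] leaves the factors along the other axes constant. *)
transitivity ((n l)%:R^-1 * \sum_m
    fourier1 R (i l) m * \prod_(j | j != l) fourier1 R (i j) (k j)).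
  congr (_ * _); apply: eq_bigr => m _.
  rewrite ffunE (bigD1 l) //= ffunE dfwith_in.
  by congr (_ * _); apply: eq_bigr => j jl; rewrite ffunE dfwith_out // eq_sym.
rewrite -mulr_suml sum_fourier1 mulrA mulKf ?pnatr_eq0 -?lt0n //.
(* At frequency 0 the factor along [l] is 1, which restores the full product. *)
rewrite [in RHS](bigD1 l) //=; case: eqP => [il|]; last by rewrite !mul0r.
by rewrite fourier1E il mul0n expr0 !mul1r.
Qed.

Lemma average_idft (l : 'I_d) Z :
  average l (idft Z) =
  idft (hadamard [ffun i : multi_index n => (i l == 0 :> nat)%:R] Z).
Proof.
apply/ffunP => k; rewrite !ffunE.
under eq_bigr => m _ do rewrite ffunE.
rewrite exchange_big mulr_sumr; apply: eq_bigr => i _.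
have := average_fourier l i k.
rewrite !ffunE -mulr_sumr mulrCA => ->.
by rewrite mulrA [Z i * _]mulrC.
Qed.

Lemma sub_average_idft (l : 'I_d) Z :
  idft Z - average l (idft Z)
  = idft (hadamard [ffun i : multi_index n => (i l != 0 :> nat)%:R] Z).
Proof.
rewrite average_idft; apply/ffunP => k; rewrite !ffunE -sumrB.
apply: eq_bigr => i _; rewrite !ffunE; case: eqP => _.
  by rewrite !mul0r mul1r subrr.
by rewrite !mul0r !mul1r subr0.
Qed.

(** Composing operators that are diagonal in the Fourier basis multiplies their 0/1 symbols, which
    amounts to a conjunction. Keeping [A] abstract covers both the averages and their
    complements. *)
Lemma big_comp_idft (P : pred 'I_d) (A : 'I_d -> tensor R n -> tensor R n)
    (b : 'I_d -> multi_index n -> bool) Z :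
  (forall l Z,
     A l (idft Z) = idft (hadamard [ffun i : multi_index n => (b l i)%:R] Z)) ->
  (\big[comp/id]_(l | P l) A l) (idft Z) =
  idft (hadamard
    [ffun i : multi_index n => [forall (l | P l), b l i]%:R] Z).
Proof.
move=> A_idft.
transitivity (idft (hadamard
    [ffun i : multi_index n => \prod_(l | P l) (b l i)%:R] Z)); last first.
  by congr idft; apply/ffunP => i; rewrite !ffunE prod_natr_bool.
elim: (index_enum _) => [|l r IHr].
  rewrite big_nil; congr idft; apply/ffunP => i.
  by rewrite !ffunE big_nil mul1r.
rewrite big_cons; case: ifP => Pl /=; rewrite IHr ?A_idft;
  congr idft; apply/ffunP => i; rewrite !ffunE big_cons Pl //.
by rewrite mulrA.
Qed.

End Fourier.

Theorem theorem4 (R : realType) (d : nat) (n : 'I_d -> nat)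
    (d_ge1 : (1 <= d)%N) (n_ge1 : forall j : 'I_d, (1 <= n j)%N)
    (X : tensor R n) (S : {set 'I_d}) :
  anova S X = idft (hadamard (anova_mask R n S) (dft X)).
Proof.
(* Only the left-hand [X] is expanded in the Fourier basis; both composed products then act on it as
   masks. *)
rewrite -{1}[X](idft_dft n_ge1) /anova /=.
rewrite (big_comp_idft _ _ (average_idft n_ge1)).
rewrite (big_comp_idft _ _ (sub_average_idft n_ge1)).
congr idft; apply/ffunP => i; rewrite !ffunE mulrA -natrM mulnb.
congr (_%:R * _); congr (nat_of_bool (_ && _)).
by apply: eq_forallb => l; rewrite inE.
Qed.
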